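(* Let $\mathcal B$ be the collection of bases of a matroid $G$ of rank $d$ on $X=\{x_1,\ldots,x_n\}$, and let $I=I(\mathcal B)$ be its basis monomial ideal. If $\mathcal B$ satisfies the packing property, then $\mathrm{gr}_I(R)$ is reduced.
   Context: Let $R=K[x_1,\ldots,x_n]$ be a polynomial ring over a field $K$. The basis monomial ideal $I(\mathcal B)$ is the ideal of $R$ generated by all square-free monomials $x_{i_1}\cdots x_{i_d}$ with $\{x_{i_1},\ldots,x_{i_d}\}\in\mathcal B$. Standing assumptions: $I$ has height at least $2$, its minimal generators have degree at least two, and each variable $x_i$ divides at least one of these generators. $\mathrm{gr}_I(R)=R/I\oplus I/I^2\oplus I^2/I^3\oplus\cdots$ is the associated graded ring of $I$. A ring is reduced if $0$ is its only nilpotent element. A clutter on a vertex set is a family of subsets (edges), none included in another; $\mathcal B$ is viewed as a clutter with vertex set $X$ whose edges are the bases. More generally, a square-free monomial ideal corresponds to the clutter whose edges are the supports of its minimal monomial generators. For disjoint sets $Y,Z\subset X$, let $I'$ be the ideal of $R'=K[X\setminus(Y\cup Z)]$ obtained from $I$ by making all variables of $Y$ equal to $0$ and all variables of $Z$ equal to $1$; when $(0)\subsetneq I'\subsetneq R'$, the clutter corresponding to $I'$ is called a minor of the clutter of $I$ (the clutter itself is a minor). For a clutter $\mathcal C$, $\alpha_0(\mathcal C)$ is the minimum cardinality of a vertex cover (a set of vertices meeting every edge), and $\beta_1(\mathcal C)$ is the maximum number of pairwise disjoint edges. $\mathcal C$ has the packing property if $\alpha_0(\mathcal C')=\beta_1(\mathcal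 C')$ for every minor $\mathcal C'$ of $\mathcal C$. *)

(* Defs.v *)
From HB Require Import structures.
From mathcomp Require Import all_boot all_order all_algebra.
From mathcomp Require Import ring_quotient generic_quotient boolp.
From mathcomp Require Import mpoly.

Set Implicit Arguments.
Unset Strict Implicit.
Unset Printing Implicit Defensive.

Import GRing.Theory.
Local Open Scope ring_scope.

(* Subsets of a ring are boolean predicates, as in ring_quotient; arbitrary
   propositions are turned into booleans with the classical asbool of boolp. *)

Section Ideals.
Variable A : comNzRingType.
Implicit Types (S I : {pred A}).

Definition ideal_span S : {pred A} :=
  fun x => `[< exists2 s : seq (A * A),
                 all (fun ab => ab.2 \in S) s & x = \sum_(ab <- s) ab.1 * ab.2 >].

Definition ideal_pow I (k : nat) : {pred A} :=
  ideal_span (fun x => `[< exists2 t : k.-tuple A,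
                             all (fun a => a \in I) t & x = \prod_(a <- t) a >]).

(* [c ord0], ..., [c ord_max] = P is a strict chain of h+1 primes. *)
Definition prime_height_ge (h : nat) (P : prime_idealr A) : Prop :=
  exists2 c : 'I_h.+1 -> prime_idealr A,
    forall i j : 'I_h.+1, (i < j)%N ->
      {subset c i <= c j} /\ ~ {subset c j <= c i}
  & c ord_max =i P.

(* The height of I is the infimum of the heights of the primes containing I. *)
Definition height_ge (h : nat) I : Prop :=
  forall P : prime_idealr A, {subset I <= P} -> prime_height_ge h P.

Lemma ideal_spanP S x :
  reflect (exists2 s : seq (A * A),
             all (fun ab => ab.2 \in S) s & x = \sum_(ab <- s) ab.1 * ab.2)
          (x \in ideal_span S).
Proof. exact: asboolP. Qed.

Lemma ideal_span_sub S : {subset S <= ideal_span S}.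
Proof.
move=> x Sx; apply/ideal_spanP; exists [:: (1, x)]; rewrite /= ?Sx //.
by rewrite big_seq1 mul1r.
Qed.

Lemma ideal_span0 S : 0 \in ideal_span S.
Proof. by apply/ideal_spanP; exists [::] => //; rewrite big_nil. Qed.

Lemma ideal_spanD S x y :
  x \in ideal_span S -> y \in ideal_span S -> x + y \in ideal_span S.
Proof.
move=> /ideal_spanP[s Ss ->] /ideal_spanP[t St ->].
by apply/ideal_spanP; exists (s ++ t); rewrite ?all_cat ?Ss // big_cat.
Qed.

Lemma ideal_spanM S a x : x \in ideal_span S -> a * x \in ideal_span S.
Proof.
move=> /ideal_spanP[s Ss ->]; apply/ideal_spanP.
exists [seq (a * ab.1, ab.2) | ab <- s]; first by rewrite all_map.
by rewrite big_map mulr_sumr; apply: eq_bigr => ab _; rewrite mulrA.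
Qed.

Lemma ideal_spanN S x : x \in ideal_span S -> - x \in ideal_span S.
Proof. by move=> Sx; rewrite -mulN1r ideal_spanM. Qed.

Lemma ideal_span_sum S (J : Type) (r : seq J) (P : pred J) (F : J -> A) :
  (forall j, P j -> F j \in ideal_span S) ->
  \sum_(j <- r | P j) F j \in ideal_span S.
Proof.
move=> SF; elim/big_ind: _ => //; [exact: ideal_span0|exact: ideal_spanD].
Qed.

Lemma ideal_pow0 I x : x \in ideal_pow I 0.
Proof.
rewrite -[x]mulr1; apply/ideal_spanM/ideal_span_sub/asboolP.
by exists [tuple] => //; rewrite big_nil.
Qed.

Lemma ideal_powM I k l x y :
  x \in ideal_pow I k -> y \in ideal_pow I l -> x * y \in ideal_pow I (k + l).
Proof.
move=> /ideal_spanP[s Ss ->] /ideal_spanP[t St ->]; rewrite mulr_suml.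
rewrite big_seq; apply: ideal_span_sum => -[a u] /= /(allP Ss) /= /asboolP[su Isu ->].
rewrite mulr_sumr big_seq.
apply: ideal_span_sum => -[b v] /= /(allP St) /= /asboolP[sv Isv ->].
rewrite mulrACA; apply/ideal_spanM/ideal_span_sub/asboolP.
by exists (cat_tuple su sv); rewrite /= ?all_cat ?Isu // big_cat.
Qed.

Lemma ideal_powS I k x : x \in ideal_pow I k.+1 -> x \in ideal_pow I k.
Proof.
move=> /ideal_spanP[s Ss ->].
rewrite big_seq; apply: ideal_span_sum => -[a u] /= /(allP Ss) /= /asboolP[t It ->].
case/tupleP: t It => b t /= /andP[_ It].
rewrite big_cons mulrA; apply/ideal_spanM/ideal_span_sub/asboolP.
by exists t.
Qed.

End Ideals.

(* The Rees algebra: polynomials whose i-th coefficient lies in I^i. *)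
Section Rees.
Variables (A : comNzRingType) (I : {pred A}).

Definition rees_pred : {pred {poly A}} :=
  fun p => `[< forall i, p`_i \in ideal_pow I i >].

Lemma rees_subring_closed : subring_closed rees_pred.
Proof.
split=> [|p q /asboolP Ip /asboolP Iq|p q /asboolP Ip /asboolP Iq]; apply/asboolP.
- case=> [|i]; first exact: ideal_pow0.
  by rewrite coef1; apply: ideal_span0.
- by move=> i; rewrite coefB; apply/ideal_spanD/ideal_spanN.
- move=> i; rewrite coefM; apply: ideal_span_sum => j _.
  have := ideal_powM (Ip j) (Iq (i - j)%N).
  by rewrite subnKC // -ltnS.
Qed.

HB.instance Definition _ :=
  GRing.isSubringClosed.Build {poly A} rees_pred rees_subring_closed.

Definition rees := {p | p \in rees_pred}.

HB.instance Definition _ := SubChoice.on rees.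
HB.instance Definition _ := [SubChoice_isSubComNzRing of rees by <:].

Lemma reesP (p : rees) i : (val p)`_i \in ideal_pow I i.
Proof. exact: (asboolW (valP p)). Qed.

(* The i-th coefficients are to be identified modulo I^(i+1). *)
Definition gr_ker : {pred rees} :=
  fun p : rees => `[< forall i, (val p)`_i \in ideal_pow I i.+1 >].

Lemma gr_kerP (p : rees) :
  reflect (forall i, (val p)`_i \in ideal_pow I i.+1) (p \in gr_ker).
Proof. exact: asboolP. Qed.

Lemma gr_ker_zmod_closed : zmod_closed gr_ker.
Proof.
split=> [|p q /gr_kerP Ip /gr_kerP Iq]; apply/gr_kerP => i.
- by rewrite rmorph0 coef0; apply: ideal_span0.
- by rewrite rmorphB coefB; apply/ideal_spanD/ideal_spanN.
Qed.

HB.instance Definition _ :=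
  GRing.isZmodClosed.Build rees gr_ker gr_ker_zmod_closed.

Lemma gr_kerMr (p q : rees) : q \in gr_ker -> p * q \in gr_ker.
Proof.
move=> /gr_kerP Iq; apply/gr_kerP => i.
rewrite rmorphM coefM; apply: ideal_span_sum => j _.
have := ideal_powM (reesP p j) (Iq (i - j)%N).
by rewrite addnS subnKC // -ltnS.
Qed.

(* The associated graded ring: as an additive group it is the direct sum of the
   I^i/I^(i+1), and the class of a in I^i times the class of b in I^j is the
   class of ab in I^(i+j)/I^(i+j+1).  It is the zero ring when I is the unit
   ideal, whence a possibly trivial ring structure. *)
Definition gr : Type := Quotient.quot gr_ker.

HB.instance Definition _ := GRing.Zmodule.on gr.
HB.instance Definition _ := EqQuotient.on gr.

Local Open Scope quotient_scope.

Definition gr_one : gr := \pi_gr 1.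
Definition gr_mul (x y : gr) : gr := \pi_gr (repr x * repr y).

Lemma gr_eqP (p q : rees) : reflect (\pi_gr p = \pi_gr q) (p - q \in gr_ker).
Proof. by rewrite Quotient.idealrBE; apply: eqP. Qed.

Lemma gr_piM (p q : rees) : \pi_gr (p * q) = gr_mul (\pi_gr p) (\pi_gr q).
Proof.
have rK r : r - repr (\pi_gr r) \in gr_ker by apply/gr_eqP; rewrite reprK.
apply/gr_eqP; set p' := repr (\pi_gr p); set q' := repr (\pi_gr q).
have -> : p * q - p' * q' = q * (p - p') + p' * (q - q').
  by rewrite !mulrBr addrA [q * p]mulrC [q * p']mulrC subrK.
by rewrite rpredD // gr_kerMr // rK.
Qed.

Lemma gr_piD (p q : rees) : \pi_gr (p + q) = \pi_gr p + \pi_gr q :> gr.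
Proof. exact: (raddfD (\pi_(Quotient.quot gr_ker))). Qed.

Lemma gr_mulA : associative gr_mul.
Proof.
move=> x y z; rewrite -[x]reprK -[y]reprK -[z]reprK.
move: (repr x) (repr y) (repr z) => p q r.
by rewrite -(gr_piM q r) -(gr_piM p q) -(gr_piM p (q * r)) -(gr_piM (p * q) r) mulrA.
Qed.

Lemma gr_mulC : commutative gr_mul.
Proof. by move=> x y; rewrite /gr_mul mulrC. Qed.

Lemma gr_mul1 : left_id gr_one gr_mul.
Proof. by move=> x; rewrite -[x]reprK /gr_one -gr_piM mul1r. Qed.

Lemma gr_mulDl : left_distributive gr_mul +%R.
Proof.
move=> x y z; rewrite -[x]reprK -[y]reprK -[z]reprK.
move: (repr x) (repr y) (repr z) => p q r.
by rewrite -gr_piD -(gr_piM p r) -(gr_piM q r) -(gr_piM (p + q) r) mulrDl gr_piD.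
Qed.

HB.instance Definition _ :=
  GRing.Zmodule_isComPzRing.Build gr gr_mulA gr_mulC gr_mul1 gr_mulDl.

End Rees.

Definition reduced (A : pzRingType) : Prop :=
  forall (x : A) (k : nat), x ^+ k = 0 -> x = 0.

Section MonomialIdeals.
Variables (K : fieldType) (n : nat).
Implicit Types (J : {pred {mpoly K[n]}}) (m : 'X_{1..n}).

Definition edge_ideal (C : {set {set 'I_n}}) : {pred {mpoly K[n]}} :=
  ideal_span (fun p => [exists e in C, p == \prod_(i in e) 'X_i]).

(* The minimal monomial generators of a monomial ideal are the monomials in it
   that are minimal for divisibility. *)
Definition min_gen J m : Prop :=
  'X_[m] \in J /\
  forall m', 'X_[m'] \in J -> (m' <= m)%MM -> m' = m.

Definition clutter_of J : {set {set 'I_n}} :=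
  [set e | `[< exists2 m, min_gen J m & e = [set i | m i != 0%N] >]].

Section Minor.
Variables Y Z : {set 'I_n}.
Local Notation V := (~: (Y :|: Z)).

(* K[X \ (Y u Z)] is {mpoly K[#|V|]}, its j-th variable being x_(enum_val j). *)
Definition minor_subst : n.-tuple {mpoly K[#|V|]} :=
  [tuple if i \in Y then 0 else if i \in Z then 1 else
         oapp (fun j : 'I_#|V| => 'X_j) 0 [pick j : 'I_#|V| | enum_val j == i]
  | i < n].

(* The substitution is surjective, so the image of an ideal is an ideal. *)
Definition minor_ideal J : {pred {mpoly K[#|V|]}} :=
  fun q => `[< exists2 p, p \in J & q = p \mPo minor_subst >].

End Minor.
End MonomialIdeals.

Arguments edge_ideal K {n} C.
Arguments minor_subst K {n} Y Z.
Arguments minor_ideal {K n} Y Z J.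

Section Clutters.
Variable T : finType.
Implicit Types (C : {set {set T}}).

Definition vertex_cover C (A : {set T}) : bool :=
  [forall e in C, A :&: e != set0].

(* Meaningful when C has a vertex cover, i.e. when no edge of C is empty. *)
Definition alpha0 C : nat := #|[arg min_(A < setT | vertex_cover C A) #|A| ]|.

Definition beta1 C : nat :=
  \max_(M : {set {set T}} | (M \subset C) && trivIset M) #|M|.

End Clutters.

Definition packing_property (K : fieldType) (n : nat) (C : {set {set 'I_n}}) : Prop :=
  forall Y Z : {set 'I_n}, [disjoint Y & Z] ->
    let I' := minor_ideal Y Z (edge_ideal K C) in
    (exists2 q, q \in I' & q != 0) -> (exists q, q \notin I') ->
    alpha0 (clutter_of I') = beta1 (clutter_of I').

Record matroid (T : finType) := Matroid {
  indep : {set {set T}};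
  indep0 : set0 \in indep;
  indep_sub : forall A B : {set T}, A \subset B -> B \in indep -> A \in indep;
  indep_aug : forall A B : {set T}, A \in indep -> B \in indep ->
    (#|A| < #|B|)%N -> exists2 x, x \in B :\: A & x |: A \in indep
}.

Definition bases (T : finType) (G : matroid T) : {set {set T}} :=
  [set B | maxset (fun A => A \in indep G) B].

Definition matroid_rank (T : finType) (G : matroid T) : nat :=
  \max_(A in indep G) #|A|.

(* Main.v *)
Require Import Defs.
From mathcomp Require Import all_boot all_order all_algebra.
From mathcomp Require Import ring_quotient generic_quotient boolp mpoly.

(** Packing is used only through one small minor.  If the matroid had a circuit
    C with at least three elements, choose three of them and pick U containing
    C such that U minus any element of C is a basis; setting to 0 the variables
    outside U and to 1 those of U other than the three chosen ones turns
    I(B) into the ideal of the triangle, whose covering number is 2 and whose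
    matching number is 1 ([triangle_minor], [circuit_bases]).  So packing makes
    every circuit have at most two elements ([packing_indep_pairs]), and as
    every variable occurs in some basis there are no loops either.  Hence
    parallelism is an equivalence relation, and the bases are exactly the
    transversals of the parallel classes X_1, ..., X_d: the ideal I is the
    product of the prime ideals P_i = (X_i).

    Since the X_i are disjoint, I^k consists of the polynomials all of whose
    monomials have degree at least k in each X_i ([ideal_pow_basesP]); a
    monomial satisfying this condition for k + 1 is divisible by a transversal,
    and dividing by it lowers each of these degrees by exactly one
    ([mpolyX_ideal_pow]).  In other words I^k is the set of the f with
    v_i(f) >= k for all i, where v_i is the order in the variables X_i, a
    valuation.

    A filtration cut out by valuations has a reduced associated graded ring
    ([gr_reduced]): the map sending an element of the Rees algebra, with
    coefficients p_j, to the family of the initial forms of degree exactly j of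
    the p_j with respect to v_i is multiplicative into a domain.  The kernels of
    these maps are therefore prime, and their intersection over i is the kernel
    of the projection of the Rees algebra onto gr_I(R). *)

Set Implicit Arguments.
Unset Strict Implicit.
Unset Printing Implicit Defensive.

Import GRing.Theory.
Local Open Scope ring_scope.

(** * Reducedness of graded rings of valuative filtrations *)

Lemma coefM_low (D : comNzRingType) (P Q : {poly D}) a b :
  (forall l, (l < a)%N -> P`_l = 0) -> (forall l, (l < b)%N -> Q`_l = 0) ->
  (P * Q)`_(a + b) = P`_a * Q`_b.
Proof.
move=> P0 Q0; rewrite coefM.
have lta : (a < (a + b).+1)%N by rewrite ltnS leq_addr.
rewrite (bigD1 (Ordinal lta)) //= addKn big1 ?addr0 // => j ja.
have [lja|laj|eja] := ltngtP j a.
- by rewrite P0 ?mul0r.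
- by rewrite Q0 ?mulr0 // ltn_subLR ?ltn_add2r // -ltnS.
- by case/eqP: ja; apply: val_inj.
Qed.

Section InitialForm.
Variables (A : comNzRingType) (D : idomainType) (s : {rmorphism A -> {poly D}}).

(** The order at X = 0 of [s f] plays the role of a valuation of [f].  When
    each [p`_j] has order at least [j], this collects their leading coefficients,
    where a coefficient of order above [j] contributes zero. *)
Definition init_form (p : {poly A}) : {poly D} :=
  \poly_(j < size p) (s p`_j)`_j.

Lemma coef_init_form p j : (init_form p)`_j = (s p`_j)`_j.
Proof.
rewrite coef_poly; case: ltnP => // lep.
by rewrite [p`_j]nth_default // rmorph0 coef0.
Qed.

Lemma init_formM (p q : {poly A}) :
  (forall j l, (l < j)%N -> (s p`_j)`_l = 0) ->
  (forall j l, (l < j)%N -> (s q`_j)`_l = 0) ->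
  init_form (p * q) = init_form p * init_form q.
Proof.
move=> p0 q0; apply/polyP => j.
rewrite coef_init_form !coefM rmorph_sum coef_sum; apply: eq_bigr => i _.
rewrite rmorphM !coef_init_form -coefM_low; [|exact: p0|exact: q0].
by rewrite subnKC // -ltnS.
Qed.

End InitialForm.

(** Each [init_form (s i)] is multiplicative on the Rees algebra and takes
    values in a domain, so a power of p is in its zero locus only if p is; and
    the kernel of the projection to [gr I] is the intersection of these loci. *)
Lemma gr_reduced (A : comNzRingType) (I : {pred A}) (D : idomainType)
    (J : Type) (s : J -> {rmorphism A -> {poly D}}) :
  (forall k f, f \in ideal_pow I k <->
     forall i l, (l < k)%N -> (s i f)`_l = 0) ->
  reduced (gr I).
Proof.
move=> powE x k; rewrite -[x]reprK; set p := repr x.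
have low i (q : rees I) j l : (l < j)%N -> (s i (val q)`_j)`_l = 0.
  by move: l; apply/powE: i; apply: reesP.
have kerE (q : rees I) :
    q \in @gr_ker A I <-> forall i, init_form (s i) (val q) = 0.
  split=> [/gr_kerP q0 i|q0].
    apply/polyP => j; rewrite coef_init_form coef0.
    exact: ((powE j.+1 _).1 (q0 j) i j (ltnSn j)).
  apply/gr_kerP => j; apply/powE => i l; rewrite ltnS leq_eqVlt.
  case/predU1P=> [->|]; last exact: low.
  by rewrite -coef_init_form q0 coef0.
have pi0 (q : rees I) : (\pi_(gr I) q = 0)%qT <-> q \in @gr_ker A I.
  (* zero has to be seen as the class of the zero of the Rees algebra *)
  rewrite -[q in X in _ <-> X]subr0; split=> [q0|/gr_eqP ->].
    apply/gr_eqP; rewrite q0; apply/esym.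
    exact: (raddf0 (\pi_(Quotient.quot (@gr_ker A I)))%qT).
  exact: (raddf0 (\pi_(Quotient.quot (@gr_ker A I)))%qT).
have piX : (\pi_(gr I) p ^+ k = \pi_(gr I) (p ^+ k))%qT.
  elim: k => [|k IHk]; first by [].
  by rewrite !exprS IHk gr_piM.
rewrite piX => /pi0/kerE pk0; apply/pi0/kerE => i.
have {pk0} := pk0 i.
have -> : init_form (s i) (val (p ^+ k)) = init_form (s i) (val p) ^+ k.
  elim: k {piX} => [|k IHk].
    rewrite !expr0 rmorph1; apply/polyP => j.
    rewrite coef_init_form coef1 coef1.
    case: j => [|j]; first by rewrite rmorph1 coef1.
    by rewrite rmorph0 coef0.
  by rewrite !exprS rmorphM init_formM ?IHk //; apply: low.
by move/eqP; rewrite expf_eq0 => /andP[_ /eqP].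
Qed.

(** * Bases and circuits of a matroid *)

Section Matroids.
Variables (T : finType) (G : matroid T).
Implicit Types (A B C U : {set T}).

Lemma indep_extend A B : A \in indep G -> B \in indep G ->
  exists D : {set T}, [/\ D \in indep G, A \subset D, D \subset A :|: B
                        & (#|B| <= #|D|)%N].
Proof.
move=> Ai Bi; pose P D := (D \in indep G) && (D \subset A :|: B).
have PA : P A by rewrite /P Ai subsetUl.
have [D /maxsetP[/andP[Di DU] maxD] AD] := maxset_exists PA.
exists D; split=> //; rewrite leqNgt; apply/negP => ltDB.
have [x /setDP[xB xD] xDi] := indep_aug Di Bi ltDB.
suff DxD: x |: D = D by rewrite -DxD setU11 in xD.
by apply: maxD; rewrite ?subsetUr // /P xDi subUset DU sub1set inE xB orbT.
Qed.

Lemma bases_indep B : B \in bases G -> B \in indep G.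
Proof. by rewrite inE => /maxsetP[]. Qed.

Lemma card_indep_bases A B : A \in indep G -> B \in bases G -> (#|A| <= #|B|)%N.
Proof.
move=> Ai; rewrite inE => /maxsetP[Bi maxB].
have [D [Di BD _]] := indep_extend Bi Ai.
by rewrite (maxB D).
Qed.

Lemma indep_card_bases A B : A \in indep G -> B \in bases G ->
  (#|B| <= #|A|)%N -> A \in bases G.
Proof.
move=> Ai BB leBA; rewrite inE; apply/maxsetP; split=> // D Di AD.
apply/esym/eqP; rewrite eqEcard AD.
exact: leq_trans (card_indep_bases Di BB) leBA.
Qed.

Lemma indep_sub_bases A : A \in indep G -> exists2 B, B \in bases G & A \subset B.
Proof.
by move=> /maxset_exists[B maxB AB]; exists B; rewrite ?inE.
Qed.

(** Extend C minus one of its elements to a basis B; then U is B together with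
    that element.  For any other c in C, an independent set as large as B that
    lies in U and contains C minus c misses c, because C is dependent, and so
    it is all of U minus c. *)
Lemma circuit_bases C : C \notin indep G ->
    (forall c, c \in C -> C :\ c \in indep G) ->
  exists2 U : {set T}, C \subset U & forall c, c \in C -> U :\ c \in bases G.
Proof.
move=> Cdep Cmin.
have [c1 c1C] : exists c, c \in C.
  by apply/set0Pn; apply: contraNneq Cdep => ->; exact: indep0.
have [B BB CB] := indep_sub_bases (Cmin _ c1C).
have CU : C \subset c1 |: B by rewrite -subDset.
exists (c1 |: B) => // c cC.
have [D [Di CD DU leBD]] := indep_extend (Cmin _ cC) (bases_indep BB).
suff -> : (c1 |: B) :\ c = D by apply: indep_card_bases BB leBD.
have cD : c \notin D.
  apply: contra Cdep => cD; apply: indep_sub Di; apply/subsetP => x xC.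
  by have [-> //|xc] := eqVneq x c; apply: (subsetP CD); rewrite !inE xc.
apply/esym/eqP; rewrite eqEcard subsetD1 cD andbT; apply/andP; split.
  apply: subset_trans DU _; rewrite subUset subsetUr andbT.
  exact: subset_trans (subsetDl _ _) CU.
have := cardsD1 c (c1 |: B); rewrite (subsetP CU _ cC) cardsU1 => cardU.
by apply: leq_trans leBD; rewrite -(leq_add2l 1) -cardU leq_add2r leq_b1.
Qed.

End Matroids.

(** * The triangle as a forbidden minor *)

(** One vertex leaves the opposite pair uncovered, and two disjoint edges would
    need four vertices. *)
Lemma alpha0_neq_beta1_triangle (T : finType) (C : {set {set T}}) :
  #|T| = 3%N -> (forall e, e \in C -> (2 <= #|e|)%N) ->
  (forall j k : T, j != k -> [set j; k] \in C) -> alpha0 C <> beta1 C.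
Proof.
move=> T3 C2 Cjk.
have coverT : vertex_cover C setT.
  apply/forall_inP => e /C2; rewrite setTI -card_gt0; exact: ltnW.
have a2 : (2 <= alpha0 C)%N.
  rewrite /alpha0; case: arg_minnP => // A /forall_inP covA _.
  rewrite leqNgt; apply/negP; rewrite ltnS => A1.
  have : (1 < #|~: A|)%N.
    by rewrite -(ltn_add2l #|A|) cardsC T3; case: #|A| A1 => [|[]].
  case/card_gt1P => j [k [jA kA jk]]; move: (covA _ (Cjk _ _ jk)).
  case/set0Pn => x; rewrite !inE => /andP[xA] /orP[] /eqP ex;
  by move: jA kA; rewrite !inE -!ex xA.
have b1 : (beta1 C <= 1)%N.
  apply/bigmax_leqP => M /andP[MC trivM]; rewrite leqNgt; apply/negP => M2.
  have : (#|cover M| <= 3)%N by apply: leq_trans (max_card _) _; rewrite T3.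
  have /eqP -> : #|cover M| == (\sum_(A in M) #|A|)%N by rewrite eq_sym.
  have : (\sum_(A in M) 2 <= \sum_(A in M) #|A|)%N.
    by apply: leq_sum => e /(subsetP MC)/C2.
  rewrite sum_nat_const => le1 le2; have := leq_trans le1 le2.
  by case: #|M| M2 => [|[|m]] //.
by move=> ab; move: a2; rewrite ab ltnNge b1.
Qed.

Section SetMonomial.
Variables (K : fieldType) (n : nat).

Definition mset (e : {set 'I_n}) : 'X_{1..n} := [multinom (i \in e : nat) | i < n].

Lemma msetE (e : {set 'I_n}) i : mset e i = (i \in e).
Proof. exact: mnmE. Qed.

Lemma mpolyX_mset (e : {set 'I_n}) : \prod_(i in e) 'X_i = 'X_[mset e] :> {mpoly K[n]}.
Proof.
rewrite mprodXE; congr 'X_[_]; apply/mnmP => j.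
rewrite mnm_sumE msetE (bigID (pred1 j)) /= [X in (_ + X)%N]big1; last first.
  by move=> i /andP[_ ij]; rewrite mnm1E (negPf ij).
rewrite addn0 big_mkcondl /= big_pred1_eq mnm1E eqxx.
by case: (j \in e).
Qed.

End SetMonomial.

Section Triangle.
Variables (K : fieldType) (n : nat) (Y Z : {set 'I_n}).
Hypothesis YZ : [disjoint Y & Z].
Local Notation V := (~: (Y :|: Z)).

Lemma minor_substY i : i \in Y -> tnth (minor_subst K Y Z) i = 0.
Proof. by rewrite tnth_mktuple => ->. Qed.

Lemma minor_substZ i : i \in Z -> tnth (minor_subst K Y Z) i = 1.
Proof. by rewrite tnth_mktuple => iZ; rewrite (disjointFl YZ iZ) iZ. Qed.

Lemma minor_substV (j : 'I_#|V|) : tnth (minor_subst K Y Z) (enum_val j) = 'X_j.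
Proof.
rewrite tnth_mktuple; have := enum_valP j; rewrite !inE negb_or.
case/andP => /negPf -> /negPf ->; case: pickP => [k /eqP/enum_val_inj -> //|].
by move/(_ j); rewrite eqxx.
Qed.

(** With three free variables, evaluating at the coordinate point e_i kills
    every generator of the minor ideal: a basis has two elements more than Z, so
    it needs a second variable besides x_i.  Hence each monomial of the minor
    ideal involves two variables, and the given bases specialize to the three
    products of two variables. *)
Lemma triangle_minor (G : matroid 'I_n) :
  #|V| = 3%N -> (forall c, c \in V -> Z :|: (V :\ c) \in bases G) ->
  ~ packing_property K (bases G).
Proof.
move=> V3 basesV /(_ Y Z YZ); set I' := minor_ideal Y Z _.
have [j0 _] : exists j : 'I_#|V|, true by rewrite V3; exists ord0.
have ZV : [disjoint Z & V] by rewrite disjoints_subset setCK subsetUr.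
have V2 c : c \in V -> #|V :\ c| = 2%N.
  by move=> cV; apply/eqP; rewrite -eqSS -V3 [in X in _ == X](cardsD1 c) cV.
have cardVB B : B \in bases G -> #|B| = (#|Z| + 2)%N.
  move=> BB; have cV := enum_valP j0; rewrite -(V2 _ cV).
  have /eqP <- : #|Z :|: V :\ enum_val j0| == (#|Z| + #|V :\ enum_val j0|)%N.
    by rewrite (leq_card_setU Z _).2 (disjointWr (subsetDl _ _)).
  apply/eqP; rewrite eqn_leq !(@card_indep_bases _ G) //.
  - exact/bases_indep/basesV.
  - exact: bases_indep.
  - exact: basesV.
(* the coordinate points of the space of the three free variables *)
pose pt (i j : 'I_#|V|) : K := (j == i)%:R.
have I'pt q i : q \in I' -> q.@[pt i] = 0.
  case/asboolP => p /ideal_spanP[s ss ->] ->.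
  rewrite comp_mpoly_meval rmorph_sum big_seq big1 //= => -[a u] /(allP ss) /=.
  case/existsP => e /andP[eB /eqP ->].
  rewrite rmorphM rmorph_prod /=.
  have [k ke kv] : exists2 k, k \in e & k \notin enum_val i |: Z.
    apply/subsetPn; apply/negP => /subset_leq_card.
    by rewrite (cardVB _ eB) cardsU1 addnC leq_add2r; case: (_ \notin _).
  rewrite (bigD1 k ke) /= mevalXU.
  move: kv; rewrite !inE negb_or => /andP[ki kZ].
  have [kY|kY] := boolP (k \in Y).
    by rewrite minor_substY // rmorph0 mul0r mulr0.
  have kV : k \in V by rewrite !inE negb_or kY.
  rewrite -(enum_rankK_in kV kV) in ki *.
  rewrite (inj_eq enum_val_inj) in ki.
  by rewrite minor_substV mevalXU /pt (negPf ki) mul0r mulr0.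
have supp2 m : 'X_[m] \in I' -> (2 <= #|[set i | m i != 0%N]|)%N.
  move=> mI; rewrite leqNgt; apply/negP; rewrite ltnS => m1.
  have [i mi] : exists i, forall j, j != i -> m j = 0%N.
    have [|[i]] := set_0Vmem [set i | m i != 0%N].
      by move=> /setP m0; exists j0 => j _; have := m0 j; rewrite !inE => /negbFE/eqP.
    move=> im; exists i => j; apply: contraNeq => mj.
    by apply/eqP; apply: (card_le1_eqP m1); rewrite // inE.
  have /eqP := I'pt _ i mI; rewrite mevalX big1 ?oner_eq0 // => j _.
  by rewrite /pt; case: eqVneq => [_|/mi ->]; rewrite ?expr1n.
have pairI' j k : j != k -> 'X_[mset [set j; k]] \in I'.
  move=> jk; apply/asboolP.
  have jkV : [set enum_val j; enum_val k] \subset V.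
    by apply/subsetP => x /set2P[] ->; exact: enum_valP.
  have /cards1P[c Vc] : #|V :\: [set enum_val j; enum_val k]| == 1%N.
    by rewrite cardsD (setIidPr jkV) V3 cards2 (inj_eq enum_val_inj) jk.
  have cV : c \in V by have := set11 c; rewrite -Vc inE => /andP[].
  have Ve : V :\ c = [set enum_val j; enum_val k].
    by rewrite -Vc setDDr setDv set0U (setIidPr jkV).
  exists (\prod_(i in Z :|: V :\ c) 'X_i).
    apply/ideal_span_sub/existsP; exists (Z :|: V :\ c).
    by rewrite basesV //=.
  rewrite rmorph_prod /= (big_setID Z) /= [X in X * _]big1 ?mul1r; last first.
    by move=> i /setIP[_ iZ]; rewrite comp_mpolyXU -tnth_nth minor_substZ.
  have -> : (Z :|: V :\ c) :\: Z = [set enum_val j; enum_val k].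
    rewrite Ve setDUl setDv set0U; apply/setDidPl.
    by rewrite disjoint_sym (disjointWr jkV).
  rewrite big_setU1 ?inE ?(inj_eq enum_val_inj) //= big_set1.
  rewrite !comp_mpolyXU -!tnth_nth !minor_substV -mpolyX_mset.
  by rewrite big_setU1 ?inE //= big_set1.
move=> pack; apply: (@alpha0_neq_beta1_triangle _ (clutter_of I')); last apply: pack.
- by rewrite card_ord.
- by move=> e; rewrite inE => /asboolP[m [mI _] ->]; exact: supp2.
- move=> j k jk; rewrite inE; apply/asboolP; exists (mset [set j; k]); last first.
    by apply/setP => i; rewrite [RHS]inE msetE; case: (i \in _).
  split=> [|m' mI' /mnm_lepP le_m']; first exact: pairI'.
  have /eqP supp_m' : [set i | m' i != 0%N] == [set j; k].
    rewrite eqEcard cards2 jk (supp2 _ mI') andbT.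
    apply/subsetP => i; rewrite inE; apply: contraNT => ijk.
    by have := le_m' i; rewrite msetE (negPf ijk) leqn0.
  apply/mnmP => i; apply/eqP; rewrite eqn_leq le_m' msetE -supp_m' inE.
  by case: (m' i).
- have /card_gt1P[j [k [_ _ jk]]] : (1 < #|'I_#|V| |)%N by rewrite card_ord V3.
  exists 'X_[mset [set j; k]]; first exact: pairI'.
  by rewrite -msupp_eq0 msuppX.
- exists 1; apply/negP => /(I'pt _ j0)/eqP.
  by rewrite rmorph1 oner_eq0.
Qed.

End Triangle.

(** * Bases as transversals of the parallel classes *)

Section ParallelClasses.
Variables (T : finType) (G : matroid T).
Hypothesis noloop : forall x, [set x] \in indep G.
Hypothesis pairsG : forall A : {set T},
  {in A &, forall x y, [set x; y] \in indep G} -> A \in indep G.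
Implicit Types (A B e : {set T}).

(** The disjunct [x == y] makes the relation reflexive: the singleton
    [set x; x] is independent when there are no loops. *)
Definition parallel x y := (x == y) || ([set x; y] \notin indep G).
Definition pclass x : {set T} := [set y | parallel x y].

Lemma parallel_trans y x z : parallel x y -> parallel y z -> parallel x z.
Proof.
rewrite /parallel.
have [-> _|xy /= dxy] := eqVneq x y; first by [].
have [<- _|yz /= dyz] := eqVneq y z; first by rewrite dxy orbT.
have [//|xz /=] := eqVneq x z; apply/negP => ixz.
have [|t] := indep_aug (noloop y) ixz; first by rewrite cards1 cards2 xz.
rewrite !inE => /andP[_ /orP[]/eqP->]; first by rewrite (negPf dxy).
by rewrite setUC (negPf dyz).
Qed.

Lemma parallelC x y : parallel x y = parallel y x.
Proof. by rewrite /parallel eq_sym setUC. Qed.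

Lemma parallel_indep e x y :
  e \in indep G -> x \in e -> y \in e -> parallel x y -> x = y.
Proof.
move=> ei xe ye /orP[/eqP //|]; rewrite (indep_sub _ ei) //.
by apply/subsetP => z /set2P[] ->.
Qed.

Lemma indep_setU1 x B : B \in indep G ->
  {in B, forall y, ~~ parallel x y} -> x |: B \in indep G.
Proof.
move=> Bi xB; have xy y : y \in B -> [set x; y] \in indep G.
  by move/xB; rewrite negb_or negbK => /andP[].
apply: pairsG => y z /setU1P[->|yB] /setU1P[->|zB].
- by rewrite setUid.
- exact: xy.
- by rewrite setUC xy.
- by apply: indep_sub Bi; apply/subsetP => t /set2P[] ->.
Qed.

Lemma bases_meet_pclass B x : B \in bases G -> exists2 y, y \in B & y \in pclass x.
Proof.
move=> BB; have [/exists_inP //|] := boolP [exists y in B, y \in pclass x].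
rewrite negb_exists => /forallP Bx.
have xBi : x |: B \in indep G.
  apply: indep_setU1 (bases_indep BB) _ => y yB.
  by have := Bx y; rewrite yB inE.
have := card_indep_bases xBi BB; rewrite cardsU1.
have -> : x \notin B by have := Bx x; rewrite inE /parallel eqxx andbT.
by rewrite ltnn.
Qed.

Lemma pclass_indep_card e x : e \in indep G -> (#|e :&: pclass x| <= 1)%N.
Proof.
move=> ei; apply/card_le1_eqP => y z /setIP[ye]; rewrite inE => xy.
case/setIP => ze; rewrite inE => xz; apply: (parallel_indep ei) => //.
by apply: (parallel_trans _ xy); rewrite parallelC.
Qed.

(** A maximal independent subset b of e is a basis: if x extended b inside a
    larger basis, an element y of e parallel to x would either extend b inside
    e, or be an element of b parallel to x, although b + x is independent. *)
Lemma transversal_sub_bases e :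
  (forall x, exists2 y, y \in e & y \in pclass x) ->
  exists2 B, B \in bases G & B \subset e.
Proof.
move=> ecl; pose P b := (b \in indep G) && (b \subset e).
have P0 : P set0 by rewrite /P indep0 sub0set.
have [b /maxsetP[/andP[bi be] maxb] _] := maxset_exists P0.
exists b => //; have [B BB bB] := indep_sub_bases bi.
suff /eqP -> : b == B by []; rewrite eqEsubset bB; apply/subsetP => x xB.
apply: contraT => xb; have [y ye] := ecl x; rewrite inE => xy.
have yb : y \in b.
  have [//|yb] := boolP (y \in b).
  suff ybb : y |: b = b by rewrite -ybb setU11 in yb.
  apply: maxb; last exact: subsetUr.
  rewrite /P subUset sub1set ye be andbT indep_setU1 // => z zb.
  apply/negP => yz; have xz : x = z.
    apply: (parallel_indep (bases_indep BB)) => //; last exact: (parallel_trans xy yz).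
    exact: (subsetP bB).
  by rewrite xz zb in xb.
case/negP: xb.
by rewrite (parallel_indep (bases_indep BB) xB _ xy) // (subsetP bB).
Qed.

End ParallelClasses.

(** A minimal dependent set with three or more elements would yield a triangle
    minor. *)
Lemma packing_indep_pairs (K : fieldType) (n : nat) (G : matroid 'I_n) (A : {set 'I_n}) :
  packing_property K (bases G) ->
  {in A &, forall x y, [set x; y] \in indep G} -> A \in indep G.
Proof.
move=> packG A2; apply: contraT => Adep.
have [C /minsetP[Cdep Cmin] CA] := minset_exists (P := fun B => B \notin indep G) Adep.
have Ci c : c \in C -> C :\ c \in indep G.
  move=> cC; apply: contraT => /Cmin/(_ (subsetDl _ _)) CE.
  by rewrite -CE !inE eqxx in cC.
have [U CU Ubases] := circuit_bases Cdep Ci.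
have [s [s_uniq s3 sC]] : exists s, [/\ uniq s, size s = 3%N & {subset s <= C}].
  apply/card_geqP; rewrite ltnNge; apply: contra Cdep => C2.
  have : (#|C| == 0) || (#|C| == 1) || (#|C| == 2)%N by case: #|C| C2 => [|[|[]]].
  case/orP => [/orP[]|/cards2P[x [y [xy CE]]]].
  - by rewrite cards_eq0 => /eqP ->; exact: indep0.
  - by case/cards1P => x CE; rewrite CE -[[set x]]setUid A2 // (subsetP CA) // CE inE.
  - by rewrite CE A2 // (subsetP CA) // CE !inE eqxx ?orbT.
pose V := [set x in s].
have VU : V \subset U.
  by apply: (subset_trans _ CU); apply/subsetP => x; rewrite inE => /sC.
have VE : ~: (~: U :|: (U :\: V)) = V.
  by rewrite setCU setCK setDE setCI setCK setIUr setICr set0U (setIidPr VU).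
have [] : ~ packing_property K (bases G); last by [].
apply: (@triangle_minor _ _ (~: U) (U :\: V)); rewrite ?VE.
- by rewrite disjoint_sym disjoints_subset setCK subsetDl.
- by rewrite cardsE; move/card_uniqP: s_uniq => ->.
- move=> c cV; have cC : c \in C by apply: sC; rewrite inE in cV.
  suff -> : U :\: V :|: V :\ c = U :\ c by exact: Ubases.
  apply/setP => x; rewrite !inE.
  have [xs|xs] := boolP (x \in s) => /=.
    by rewrite (subsetP VU) ?inE ?xs ?andbT.
  suff -> : x != c by rewrite orbF.
  by apply: contraNneq xs => ->; rewrite inE in cV.
Qed.

(** * Degrees in a set of variables *)

Section PartialDegree.
Variables (K : fieldType) (n : nat).
Implicit Types (A : {set 'I_n}) (m : 'X_{1..n}).

Definition partial_deg A m : nat := \sum_(a in A) m a.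

(** Substituting x_a X for x_a when a is in A records the degree in the
    variables of A as the degree in the new variable X, so that the order at
    X = 0 of the image is the least partial degree of a monomial. *)
Definition homogenize A : {rmorphism {mpoly K[n]} -> {poly {mpoly K[n]}}} :=
  mmap (polyC \o @mpolyC n K) (fun a => ('X_a)%:P * 'X^(a \in A)).

Lemma homogenizeX A m : homogenize A 'X_[m] = ('X_[m])%:P * 'X^(partial_deg A m).
Proof.
rewrite [LHS]mmapX /mmap1.
rewrite (eq_bigr (fun a => (('X_a)%:P ^+ m a) * 'X^(m a * (a \in A)))); last first.
  by move=> a _; rewrite exprMn -exprM mulnC.
rewrite big_split /= mpolyXE_id rmorph_prod /=; congr (_ * _).
  by apply: eq_bigr => a _; rewrite rmorphXn.
rewrite prodrXr; congr ('X^_); rewrite /partial_deg [RHS]big_mkcond.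
by apply: eq_bigr => a _; case: (a \in A); rewrite ?muln1 ?muln0.
Qed.

Lemma coef_homogenize A f l m :
  ((homogenize A f)`_l)@_m = f@_m *+ (partial_deg A m == l).
Proof.
rewrite [in LHS](mpolyE f) [in RHS](mpolyE f) rmorph_sum coef_sum !raddf_sum.
rewrite /= -sumrMnl; apply: eq_bigr => m' _ /=.
rewrite -mul_mpolyC rmorphM homogenizeX [homogenize A _]mmapC /=.
rewrite mulrA -rmorphM coefMXn coefC subn_eq0 mul_mpolyC.
have [<-|m'm] := eqVneq m' m.
  by case: ltngtP; rewrite ?mcoeff0 ?mulr0n ?mulr1n.
rewrite mcoeffZ mcoeffX (negPf m'm) mulr0 mul0rn.
case: ifP => _; rewrite ?mcoeff0 //; case: ifP => _; rewrite ?mcoeff0 //.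
by rewrite mcoeffZ mcoeffX (negPf m'm) mulr0.
Qed.

Lemma homogenize_low A f k m :
  (forall l, (l < k)%N -> (homogenize A f)`_l = 0) ->
  m \in msupp f -> (k <= partial_deg A m)%N.
Proof.
move=> low mf; rewrite leqNgt; apply/negP => /low/(congr1 (mcoeff m)).
rewrite coef_homogenize eqxx mcoeff0 mulr1n => /eqP.
by rewrite mcoeff_eq0 mf.
Qed.

Lemma partial_degD A m1 m2 :
  partial_deg A (m1 + m2)%MM = (partial_deg A m1 + partial_deg A m2)%N.
Proof. by rewrite /partial_deg -big_split; apply: eq_bigr => a _; rewrite mnmDE. Qed.

Lemma partial_deg_mset A (e : {set 'I_n}) : partial_deg A (mset e) = #|e :&: A|.
Proof.
rewrite /partial_deg -sum1_card setIC [RHS](eq_bigl [pred i | (i \in A) && (i \in e)]).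
  by rewrite big_mkcondr; apply: eq_bigr => a _; rewrite msetE; case: (a \in e).
by move=> i; rewrite !inE.
Qed.

End PartialDegree.

(** Order at least k at X = 0 is stated as divisibility by X^k with an explicit
    cofactor, since cofactors simply add up in sums and multiply in products. *)
Lemma ideal_span_low (S : comNzRingType) (A : comNzRingType) (I : {pred A})
    (s : {rmorphism A -> {poly S}}) k x :
  (forall y, y \in I -> exists Q, s y = Q * 'X^k) -> x \in ideal_span I ->
  exists Q, s x = Q * 'X^k.
Proof.
move=> Ik /ideal_spanP[t It ->]; rewrite rmorph_sum big_seq.
elim/big_ind: _ => [|x1 x2 [Q1 ->] [Q2 ->]|[a u] /(allP It)/Ik /= [Q sQ]].
- by exists 0; rewrite mul0r.
- by exists (Q1 + Q2); rewrite mulrDl.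
- by exists (s a * Q); rewrite rmorphM sQ mulrA.
Qed.

Lemma ideal_pow_low (S : comNzRingType) (A : comNzRingType) (I : {pred A})
    (s : {rmorphism A -> {poly S}}) k x :
  (forall y, y \in I -> exists Q, s y = Q * 'X) -> x \in ideal_pow I k ->
  exists Q, s x = Q * 'X^k.
Proof.
move=> I1; apply: ideal_span_low => y /asboolP[t It ->].
elim: k t It => [|k IHk] t; first by exists (s (\prod_(a <- t) a)); rewrite mulr1.
case/tupleP: t => b t /= /andP[/I1[Qb sb] /IHk[Q st]].
by exists (Qb * Q); rewrite big_cons rmorphM sb st exprS mulrACA.
Qed.

(** * Powers of the basis monomial ideal *)

Section Transversals.
Variables (K : fieldType) (n : nat) (G : matroid 'I_n).
Local Notation I := (edge_ideal K (bases G)).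

(** At the indicator vector of the support of m the monomial takes the value 1,
    while a generator whose support is not contained in that of m vanishes. *)
Lemma mem_edge_idealX m :
  'X_[m] \in I -> exists2 e, e \in bases G & e \subset [set i | m i != 0%N].
Proof.
case/ideal_spanP => s Is mE; apply/exists_inP; apply: contraT.
rewrite negb_exists => /forallP noe.
have /eqP := congr1 (meval (fun i => (m i != 0%N)%:R : K)) mE.
rewrite mevalX big1; last by move=> i _; case: eqP => [->|]; rewrite ?expr1n.
rewrite rmorph_sum big_seq big1 ?oner_eq0 // => -[a u] /(allP Is).
case/exists_inP=> e eB /eqP /= ->.
have := noe e; rewrite eB => /subsetPn[k ke]; rewrite inE negbK => /eqP mk.
by rewrite rmorphM rmorph_prod (bigD1 k ke) /= mevalXU mk eqxx mul0r mulr0.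
Qed.

(** A minimal generator is the monomial of a basis, because it is divisible by
    one. *)
Lemma covered_noloop :
  (forall i : 'I_n, exists2 m, min_gen I m & (0 < m i)%N) ->
  forall x, [set x] \in indep G.
Proof.
move=> cov x; have [m [mI minm] mx] := cov x.
have [e eB em] := mem_edge_idealX mI.
have eI : 'X_[mset e] \in I.
  by apply/ideal_span_sub/exists_inP; exists e; rewrite ?mpolyX_mset.
have me : mset e = m.
  apply: minm eI _; apply/mnm_lepP => i; rewrite msetE.
  by case: (boolP (i \in e)) => // /(subsetP em); rewrite inE lt0n.
apply: indep_sub (bases_indep eB); rewrite sub1set.
by move: mx; rewrite -me msetE; case: (x \in e).
Qed.

Hypothesis noloop : forall x, [set x] \in indep G.
Hypothesis pairsG : forall A : {set 'I_n},
  {in A &, forall x y, [set x; y] \in indep G} -> A \in indep G.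

(** The support of m meets every parallel class, so it contains a basis e; e
    meets each class only once, and dividing m by the monomial of e costs one
    in each degree. *)
Lemma mpolyX_ideal_pow k m :
  (forall i, (k <= partial_deg (pclass G i) m)%N) -> 'X_[m] \in ideal_pow I k.
Proof.
elim: k m => [|k IHk] m degm; first exact: ideal_pow0.
have [e eB em] : exists2 e, e \in bases G & e \subset [set i | m i != 0%N].
  apply: transversal_sub_bases => // i.
  have : (0 < partial_deg (pclass G i) m)%N by apply: leq_trans (degm i).
  rewrite lt0n sum_nat_eq0 negb_forall => /existsP[j].
  by rewrite negb_imply => /andP[ji mj]; exists j; rewrite ?inE // in ji *.
have em' : (mset e <= m)%MM.
  apply/mnm_lepP => i; rewrite msetE.
  by case: (boolP (i \in e)) => // /(subsetP em); rewrite inE lt0n.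
rewrite -(submK em') mpolyXD -addn1; apply: ideal_powM.
  apply: IHk => i; have := degm i.
  rewrite -{1}(submK em') partial_degD partial_deg_mset -addn1 => degk.
  rewrite -(leq_add2r 1); apply: leq_trans degk _.
  by rewrite leq_add2l pclass_indep_card // bases_indep.
apply/ideal_span_sub/asboolP; exists [tuple 'X_[mset e]]; last by rewrite big_seq1.
rewrite /= andbT; apply/ideal_span_sub/exists_inP; exists e => //.
by rewrite mpolyX_mset.
Qed.

(** This is the equality of I^k with the intersection of the P_i^k, the classes
    being indexed, with repetitions, by their elements. *)
Lemma ideal_pow_basesP k f :
  f \in ideal_pow I k <->
  forall i l, (l < k)%N -> (homogenize K (pclass G i) f)`_l = 0.
Proof.
split=> [fI i l ltlk|low].
  have [|Q ->] := ideal_pow_low (s := homogenize K (pclass G i)) _ fI; last first.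
    by rewrite coefMXn ltlk.
  move=> y yI; rewrite -['X]expr1; apply: ideal_span_low yI => {}y.
  case/exists_inP=> e eB /eqP ->; rewrite mpolyX_mset homogenizeX partial_deg_mset.
  have [j je ji] := bases_meet_pclass noloop pairsG i eB.
  exists (('X_[mset e])%:P * 'X^(#|e :&: pclass G i|.-1)).
  rewrite -mulrA -exprD addn1 prednK //.
  by rewrite card_gt0; apply/set0Pn; exists j; rewrite inE je.
rewrite [f]mpolyE big_seq; apply: ideal_span_sum => m mf.
rewrite -mul_mpolyC; apply/ideal_spanM/mpolyX_ideal_pow => i.
by apply: homogenize_low mf; exact: low.
Qed.

End Transversals.

Theorem proposition4p25 (K : fieldType) (n d : nat) (G : matroid 'I_n) :
  let I : {pred {mpoly K[n]}} := edge_ideal K (bases G) in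
  matroid_rank G = d ->
  height_ge 2 I ->
  (forall m : 'X_{1..n}, min_gen I m -> (2 <= mdeg m)%N) ->
  (forall i : 'I_n, exists2 m : 'X_{1..n}, min_gen I m & (0 < m i)%N) ->
  packing_property K (bases G) ->
  reduced (gr I).
Proof.
move=> I _ _ _ covered packG.
have noloop := covered_noloop covered.
have pairsG A := @packing_indep_pairs K n G A packG.
exact: gr_reduced (ideal_pow_basesP noloop pairsG).
Qed.
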